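(* Let $G$ be a connected graph, and let $r\ge 0$ be the number of full vertices of $G$. If $G$ admits an idomatic partition, then $IC(G)\ge 2\,id(G)-r$.
   Context: Graphs are finite and simple. A full vertex of a graph of order $n$ is a vertex of degree $n-1$. A set $S$ of vertices is dominating if every vertex is in $S$ or adjacent to a vertex of $S$; it is independent if its vertices are pairwise nonadjacent; an independent dominating set is a set that is both independent and dominating. An idomatic partition of $G$ is a partition of $V(G)$ into independent dominating sets; the idomatic number $id(G)$ is the maximum number of classes of an idomatic partition of $G$. An independent coalition in $G$ consists of two disjoint independent sets of vertices $V_1,V_2$, neither of which is an independent dominating set but whose union $V_1\cup V_2$ is an independent dominating set; one says that $V_1$ and $V_2$ form an independent coalition. An $ic$-partition of $G$ is a partition $\pi=\{V_1,\dots,V_k\}$ of $V(G)$ into nonempty sets such that every $V_i\in\pi$ either is a singleton dominating set (a dominating set of cardinality 1), or is not an independent dominating set but forms an independent coalition with another set $V_j\in\pi$. The independent coalition number $IC(G)$ is the maximum number of classes of an $ic$-partition of $G$; a relation about the value of $IC(G)$ includes the assertion that $G$ has an $ic$-partition. *)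

(* Defs.v *)
From mathcomp Require Import all_boot.

Set Implicit Arguments.
Unset Strict Implicit.
Unset Printing Implicit Defensive.

(* A finite simple graph is a symmetric irreflexive relation [e] on a finite
   type [T] of vertices. *)

Definition connected_graph (T : finType) (e : rel T) : Prop :=
  forall x y : T, connect e x y.

Definition degree (T : finType) (e : rel T) (x : T) : nat :=
  #|[set y | e x y]|.

Definition full_vertex (T : finType) (e : rel T) (x : T) : bool :=
  degree e x == #|T|.-1.

Definition full_vertices (T : finType) (e : rel T) : {set T} :=
  [set x | full_vertex e x].

Definition dominating (T : finType) (e : rel T) (S : {set T}) : bool :=
  [forall x, (x \in S) || [exists y in S, e x y]].

Definition independent (T : finType) (e : rel T) (S : {set T}) : bool :=
  [forall x in S, forall y in S, ~~ e x y].

Definition independent_dominating (T : finType) (e : rel T) (S : {set T}) :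
    bool :=
  independent e S && dominating e S.

(* [partition] already requires the classes to be nonempty. *)
Definition idomatic_partition (T : finType) (e : rel T) (P : {set {set T}}) :
    bool :=
  partition P [set: T] && [forall S in P, independent_dominating e S].

(* This maximum, like the one in [IC_number], is 0 when no such partition
   exists, so it is only meaningful together with an existence statement. *)
Definition idomatic_number (T : finType) (e : rel T) : nat :=
  \max_(P : {set {set T}} | idomatic_partition e P) #|P|.

Definition independent_coalition (T : finType) (e : rel T) (A B : {set T}) :
    bool :=
  [&& [disjoint A & B], independent e A, independent e B,
      ~~ independent_dominating e A, ~~ independent_dominating e B
    & independent_dominating e (A :|: B)].

Definition ic_partition (T : finType) (e : rel T) (P : {set {set T}}) : bool :=
  partition P [set: T] &&
  [forall A in P,
     ((#|A| == 1) && dominating e A)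
     || (~~ independent_dominating e A
         && [exists B in P, (B != A) && independent_coalition e A B])].

Definition IC_number (T : finType) (e : rel T) : nat :=
  \max_(P : {set {set T}} | ic_partition e P) #|P|.

(* Main.v *)
Require Import Defs.
From mathcomp Require Import all_boot.

Set Implicit Arguments.
Unset Strict Implicit.
Unset Printing Implicit Defensive.

(** Take an idomatic partition [P] with the maximum number of classes and cut
    every class in two.  A proper subset of an independent set never dominates,
    since a vertex left out has no neighbour in the set; hence the two halves
    of a class, when both are nonempty, form an independent coalition
    ([split_coalition]).  A class that cannot be cut is a singleton; it
    dominates, so its vertex is full ([dominating1_full]).  At most
    [#|full_vertices e|] classes therefore stay whole while all the others
    count twice.

    To cut all the classes at once, choose a transversal [X] of [P] and
    separate each class [B] into [B :&: X], which is a singleton, and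
    [B :\: X], which is empty exactly when [B] is a singleton. *)

Section Splitting.

Variable T : finType.
Implicit Types (P : {set {set T}}) (B D X : {set T}) (p : {set T} * bool).

Definition half X p : {set T} := if p.2 then p.1 :&: X else p.1 :\: X.

Definition halves P X : {set {set T} * bool} :=
  [set p in setX P [set: bool] | half X p != set0].

Lemma half_sub X p : half X p \subset p.1.
Proof. by rewrite /half; case: p.2; rewrite ?subsetIl ?subsetDl. Qed.

Lemma half_disjoint X B b : [disjoint half X (B, b) & half X (B, ~~ b)].
Proof.
rewrite -setI_eq0; apply/eqP/setP=> x.
by case: b; rewrite !inE; case: (x \in B); case: (x \in X).
Qed.

Lemma half_cover X B b : half X (B, b) :|: half X (B, ~~ b) = B.
Proof. by case: b; rewrite /half /= 1?setUC ?setID // setUC setID. Qed.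

(** Indexing the halves by pairs (class, side) makes the number of classes of
    the refinement that of [halves P X], by injectivity. *)
Lemma halves_partition P D X :
  partition P D ->
  partition (half X @: halves P X) D /\ {in halves P X &, injective (half X)}.
Proof.
move=> partP; have /trivIsetP trivP := partition_trivIset partP.
have [||partQ inj_half] := @indexed_partition _ _ (mem (halves P X)) (half X).
- move=> [B b] [C c]; rewrite !inE !andbT /= => /andP[PB _] /andP[PC _].
  have [<-{C PC}|neqBC _] := eqVneq B C; last first.
    by apply: disjointW (half_sub _ _) (half_sub _ _) _; apply: trivP.
  rewrite xpair_eqE eqxx /= => neq_cb.
  by have -> : c = ~~ b by [case: b c neq_cb => [] []]; apply: half_disjoint.
- by move=> p Qp; have /[!inE]/andP[] : p \in halves P X := Qp.
split=> //; suff <- : cover (half X @: halves P X) = D by [].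
rewrite -(cover_partition partP); apply/setP=> x; apply/bigcupP/bigcupP.
  case=> _ /imsetP[[B b] Qp ->] Ax; have /[!inE]/andP[/andP[PB _] _] := Qp.
  by exists B => //; apply: subsetP (half_sub _ _) _ Ax.
case=> B PB Bx; exists (half X (B, x \in X)); last first.
  by rewrite /half /=; case: ifP => Xx; rewrite inE Bx Xx.
apply: imset_f; rewrite !inE PB; apply/set0Pn; exists x.
by rewrite /half /=; case: ifP => Xx; rewrite inE Bx Xx.
Qed.

End Splitting.

Section Graphs.

Variables (T : finType) (e : rel T).
Implicit Types (A B C D X : {set T}) (P : {set {set T}}).

Lemma independentS A B : A \subset B -> independent e B -> independent e A.
Proof.
move=> /subsetP sAB /forall_inP indB; apply/forall_inP=> x /sAB Bx.
by apply/forall_inP=> y /sAB By; apply: (forall_inP (indB x Bx)).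
Qed.

Lemma proper_not_dominating A B :
  independent e B -> A \proper B -> ~~ dominating e A.
Proof.
move=> /forall_inP indB /properP[/subsetP sAB [x Bx notAx]].
apply/forallPn; exists x; rewrite negb_or notAx.
by apply/exists_inPn=> y /sAB By; apply: (forall_inP (indB x Bx)).
Qed.

Lemma split_coalition A C :
    [disjoint A & C] -> A != set0 -> C != set0 ->
    independent_dominating e (A :|: C) ->
  independent_coalition e A C.
Proof.
move=> disAC A0 C0 idAC; have [indAC _] := andP idAC.
have notdom B D : [disjoint B & D] -> D != set0 -> independent e (B :|: D) ->
    ~~ independent_dominating e B.
  move=> disBD /set0Pn[x Dx] indBD; rewrite negb_and.
  rewrite (proper_not_dominating indBD) ?orbT //.
  apply/properP; split; first exact: subsetUl.
  by exists x; rewrite ?inE ?Dx ?orbT // (disjointFl disBD Dx).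
apply/and5P; split=> //; rewrite ?(independentS _ indAC) ?subsetUl ?subsetUr //.
  exact: notdom indAC.
by rewrite idAC andbT (notdom C A) // 1?disjoint_sym // setUC.
Qed.

Lemma dominating1_full v :
  symmetric e -> irreflexive e -> dominating e [set v] -> full_vertex e v.
Proof.
move=> e_sym e_irr /forallP domv; rewrite /full_vertex /degree.
suff -> : [set y | e v y] = [set~ v] by rewrite cardsC1.
apply/setP=> y; rewrite !inE; have [->|neq_yv] := eqVneq y v.
  by rewrite e_irr.
have /orP[|/exists_inP[w /set1P->]] := domv y; last by rewrite e_sym.
by rewrite inE (negPf neq_yv).
Qed.

Section Transversal.

Variables (P : {set {set T}}) (X : {set T}).
Hypotheses (idomP : idomatic_partition e P)
           (trX : is_transversal X P [set: T]).

Let partP : partition P [set: T]. Proof. by case/andP: idomP. Qed.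

Let idP B : B \in P -> independent_dominating e B.
Proof. by case/andP: idomP => _ /forall_inP; apply. Qed.

Let cardX B : B \in P -> #|B :&: X| = 1.
Proof.
by case/and3P: trX => _ _ /forall_inP trB /trB /eqP <-; rewrite setIC.
Qed.

Let halfT_neq0 B : B \in P -> half X (B, true) != set0.
Proof. by move=> PB; rewrite -card_gt0 /half /= cardX. Qed.

(** The partner of a half is the other half of the same class; when that one is
    empty, the half is a whole class inside the transversal, hence a singleton
    dominating set. *)
Lemma halves_ic_partition : ic_partition e (half X @: halves P X).
Proof.
have [partQ _] := halves_partition X partP.
rewrite /ic_partition partQ; apply/forall_inP=> _ /imsetP[[B b] Qp ->].
have /[!inE]/andP[/andP[/= PB _] A0] := Qp.
have defB := half_cover X B b.
have [C0|C0] := eqVneq (half X (B, ~~ b)) set0.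
  have b_true : b.
    by case: (b) C0 => // /eqP; rewrite (negPf (halfT_neq0 PB)).
  move: defB; rewrite C0 setU0 => ->.
  apply/orP; left; case/andP: (idP PB) => _ ->; rewrite andbT.
  move: C0; rewrite b_true /half /= => /eqP; rewrite setD_eq0 => sBX.
  by rewrite -(setIidPl sBX) cardX.
have coal : independent_coalition e (half X (B, b)) (half X (B, ~~ b)).
  by apply: split_coalition; rewrite ?half_disjoint // defB idP.
case/and5P: (coal) => disAC _ _ -> _; apply/orP; right.
apply/exists_inP; exists (half X (B, ~~ b)).
  by apply: imset_f; rewrite !inE PB C0.
rewrite coal andbT; apply: contraNneq A0 => eqCA.
by rewrite -setI_eq0 eqCA setIid in disAC.
Qed.

(** A pair (class, side) with an empty half has the form ([[set v]], [false])
    with [v] full, so these pairs are at most as many as the full vertices. *)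
Lemma card_halves :
  symmetric e -> irreflexive e ->
  2 * #|P| - #|full_vertices e| <= #|half X @: halves P X|.
Proof.
move=> e_sym e_irr; have [_ inj_half] := halves_partition X partP.
rewrite (card_in_imset inj_half) leq_subLR addnC.
have -> : 2 * #|P| = #|setX P [set: bool]|.
  by rewrite cardsX cardsT card_bool mulnC.
pose E := [set ([set v], false) | v in full_vertices e].
have sub : setX P [set: bool] \subset halves P X :|: E.
  apply/subsetP=> -[B b] PBb; rewrite in_setU inE PBb /=.
  have [C0|//] := eqVneq; apply/imsetP => /=.
  have PB : B \in P by move: PBb; rewrite inE => /andP[].
  case: b C0 {PBb} => [/eqP|/eqP]; first by rewrite (negPf (halfT_neq0 PB)).
  rewrite /half /= setD_eq0 => /setIidPl defB.
  have /eqP/cards1P[v defv] := cardX PB; rewrite defB in defv.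
  exists v; last by rewrite defv.
  by rewrite inE dominating1_full // -defv; case/andP: (idP PB).
apply: leq_trans (subset_leq_card sub) (leq_trans (leq_card_setU _ _) _).
by rewrite leq_add2l leq_imset_card.
Qed.

End Transversal.

End Graphs.

Theorem theorem2p6 (T : finType) (e : rel T)
    (e_sym : symmetric e) (e_irr : irreflexive e)
    (e_conn : connected_graph e)
    (e_idom : exists P : {set {set T}}, idomatic_partition e P) :
  (exists Q : {set {set T}}, ic_partition e Q) /\
  IC_number e >= 2 * idomatic_number e - #|full_vertices e|.
Proof.
have [P idomP defid] : {P | idomatic_partition e P & idomatic_number e = #|P|}.
  apply: (@eq_bigmax_cond _ (idomatic_partition e)).
  by case: e_idom => P0 idomP0; apply/card_gt0P; exists P0.
have trX := transversalP (proj1 (andP idomP)).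
have icQ := halves_ic_partition idomP trX.
split; first by eexists; apply: icQ.
rewrite defid; apply: leq_trans (card_halves idomP trX e_sym e_irr) _.
exact: (@leq_bigmax_cond _ (ic_partition e) (fun Q => #|Q|) _ icQ).
Qed.
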